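(* Let $\psi: T \to \mathbb{C}$ be a function and $\varphi: T \to T$ a self-map with infinite range (i.e. $\varphi(T)$ is infinite) for which $W_{\psi,\varphi}$ is bounded on $L_\mu^\infty$ (respectively $L_\mu^0$). Then $W_{\psi,\varphi}$ is compact on $L_\mu^\infty$ (respectively $L_\mu^0$) if and only if $$\lim_{N \to \infty}\ \sup_{|\varphi(v)| \ge N} \frac{\mu(v)}{\mu(\varphi(v))}|\psi(v)| = 0,$$ where the supremum is over all $v \in T$ with $|\varphi(v)| \ge N$.
   Context: $(T,\mathrm{d})$ is a metric space with a distinguished point $o$ (the root); the length of $v \in T$ is $|v| = \mathrm{d}(o,v)$. $T$ is assumed locally finite (for every $M>0$ the set $\{v \in T : |v| < M\}$ is finite) and unbounded (for every $M>0$ there is $v \in T$ with $|v| \ge M$). $\mu: T \to (0,\infty)$ is an arbitrary positive function (a weight). $L_\mu^\infty$ is the Banach space of functions $f: T \to \mathbb{C}$ with $\|f\|_\mu = \sup_{v \in T} \mu(v)|f(v)| < \infty$, and $L_\mu^0$ is its closed subspace of those $f$ with $\lim_{|v|\to\infty} \mu(v)|f(v)| = 0$. The weighted composition operator is the linear map $W_{\psi,\varphi} f = \psi\,(f\circ\varphi)$; it is bounded (compact) on a space if it is a bounded (compact) operator from that space to itself. *)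

(* Defs.v *)
From HB Require Import structures.
From mathcomp Require Import all_boot all_order all_algebra.
From mathcomp Require Import all_classical all_reals all_analysis.
From mathcomp Require Import complex.

Set Implicit Arguments.
Unset Strict Implicit.
Unset Printing Implicit Defensive.

Import Order.TTheory GRing.Theory Num.Theory.
Import numFieldNormedType.Exports.

Local Open Scope classical_set_scope.
Local Open Scope ring_scope.
Local Open Scope complex_scope.

Notation modulus := ComplexField.Normc.normc.

Lemma modulus_ge0 (R : realType) (z : R[i]) : 0 <= modulus z.
Proof. by case: z => ? ?; exact: sqrtr_ge0. Qed.

Section weighted_sup.
Context {R : realType} {T : Type} (mu : T -> {posnum R}).

(* takes the value +oo exactly when f is not in L^oo_mu *)
Definition wsup (f : T -> R[i]) : \bar R :=
  ereal_sup [set ((mu v)%:num * modulus (f v))%:E | v in [set: T]].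

Definition Linf_pred : {pred T -> R[i]} := mem [set f | (wsup f < +oo)%E].

Record Linf := MkLinf { Linf_fun :> T -> R[i] ; _ : Linf_fun \in Linf_pred }.

HB.instance Definition _ := [isSub for Linf_fun].
HB.instance Definition _ := [Choice of Linf by <:].

Lemma Linf_predP (f : T -> R[i]) :
  f \in Linf_pred <-> exists2 c : R, 0 <= c &
    forall v, (mu v)%:num * modulus (f v) <= c.
Proof.
rewrite inE/=; split=> [fo|[c c0 fc]].
  exists (Num.max 0 (fine (wsup f))); first by rewrite le_max lexx.
  move=> v; rewrite le_max; apply/orP; right.
  have fv : (((mu v)%:num * modulus (f v))%:E <= wsup f)%E.
    by apply: ereal_sup_ubound; exists v.
  rewrite -lee_fin fineK// fin_numElt fo andbT.
  by rewrite (lt_le_trans _ fv)// ltNyr.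
apply: (@le_lt_trans _ _ c%:E); last exact: ltry.
by apply: ge_ereal_sup => _ [v _ <-]; rewrite lee_fin.
Qed.

Lemma Linf_submod_closed : submod_closed Linf_pred.
Proof.
split=> [|a f g /Linf_predP[c c0 fc] /Linf_predP[d d0 gd]]; apply/Linf_predP.
  by exists 0 => // v; rewrite ComplexField.Normc.normc0 mulr0.
exists (modulus a * c + d).
  by rewrite addr_ge0// mulr_ge0// modulus_ge0.
move=> v; apply: (@le_trans _ _ ((mu v)%:num *
    (modulus (a * f v) + modulus (g v)))).
  by rewrite ler_wpM2l// le_normcD.
rewrite ComplexField.Normc.normcM mulrDr lerD// mulrCA.
by rewrite ler_wpM2l// modulus_ge0.
Qed.

HB.instance Definition _ :=
  GRing.isSubmodClosed.Build _ _ Linf_pred Linf_submod_closed.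
HB.instance Definition _ := [SubChoice_isSubLmodule of Linf by <:].

(* the scalars are complex, so the norm takes its (real) values in R[i] *)
Definition Linf_norm (f : Linf) : R[i] := (fine (wsup f))%:C.

Lemma wsup_ub (f : Linf) v : (mu v)%:num * modulus (f v) <= fine (wsup f).
Proof.
have /set_mem/= fo := valP f.
have fv : (((mu v)%:num * modulus (f v))%:E <= wsup f)%E.
  by apply: ereal_sup_ubound; exists v.
rewrite -lee_fin fineK// fin_numElt fo andbT.
by rewrite (lt_le_trans _ fv)// ltNyr.
Qed.

Lemma wsup_le (f : Linf) (c : R) : 0 <= c ->
  (forall v, (mu v)%:num * modulus (f v) <= c) -> fine (wsup f) <= c.
Proof.
move=> c0 fc; have : (wsup f <= c%:E)%E.
  by apply: ge_ereal_sup => _ [v _ <-]; rewrite lee_fin.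
by case: (wsup f) => [r| |].
Qed.

Lemma wsup_ge0 (f : Linf) : 0 <= fine (wsup f).
Proof.
case: (pselect ([set: T] !=set0)) => [[v _]|T0].
  apply: le_trans (wsup_ub f v).
  by rewrite mulr_ge0 ?modulus_ge0.
rewrite /wsup (_ : [set: T] = set0) ?image_set0 ?ereal_sup0//.
by apply/seteqP; split=> // v _; apply: T0; exists v.
Qed.

Lemma Linf_normD (f g : Linf) :
  Linf_norm (f + g) <= Linf_norm f + Linf_norm g.
Proof.
rewrite /Linf_norm -rmorphD lecR wsup_le ?addr_ge0 ?wsup_ge0// => v.
apply: (le_trans _ (lerD (wsup_ub f v) (wsup_ub g v))).
by rewrite -mulrDr ler_wpM2l// le_normcD.
Qed.

Lemma Linf_normZ (a : R[i]) (f : Linf) :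
  Linf_norm (a *: f) = `|a| * Linf_norm f.
Proof.
have le b (h : Linf) : fine (wsup (b *: h)) <= modulus b * fine (wsup h).
  rewrite wsup_le ?mulr_ge0 ?wsup_ge0 ?modulus_ge0// => v.
  rewrite [modulus _]ComplexField.Normc.normcM mulrCA.
  by rewrite ler_wpM2l ?modulus_ge0 ?wsup_ub.
have -> : `|a| = (modulus a)%:C by case: a.
rewrite /Linf_norm -rmorphM; congr (_%:C).
apply/eqP; rewrite eq_le le andTb.
have [->|a0] := eqVneq a 0.
  by rewrite ComplexField.Normc.normc0 mul0r; exact: wsup_ge0.
have := le a^-1 (a *: f); rewrite scalerA mulVf// scale1r.
rewrite ComplexField.Normc.normcV mulrC ler_pdivlMr 1?mulrC//.
rewrite lt_neqAle modulus_ge0 andbT eq_sym.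
exact: (contra_neq (@ComplexField.Normc.eq0_normc R a)).
Qed.

Lemma Linf_norm0_eq0 (f : Linf) : Linf_norm f = 0 -> f = 0.
Proof.
move=> [f0]; apply/val_inj/funext => v /=.
apply: ComplexField.Normc.eq0_normc; apply/eqP.
have /= := wsup_ub f v; rewrite f0 pmulr_rle0// => fv0.
by rewrite eq_le fv0 modulus_ge0.
Qed.

HB.instance Definition _ := Lmodule_isNormed.Build R[i] Linf
  Linf_normD Linf_normZ Linf_norm0_eq0.

End weighted_sup.

Section vanishing.
Context {R : realType} {T : metricType R} (o : T) (mu : T -> {posnum R}).

(* the neighbourhoods of infinity in T, in the sense |v| = d(o, v) -> oo *)
Definition at_infinity : set_system T :=
  filter_from [set: R] (fun M => [set v | M <= mdist o v]).

Definition L0_pred : {pred Linf mu} :=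
  mem [set f : Linf mu |
    (mu v)%:num * modulus (f v) @[v --> at_infinity] --> (0 : R)].

Record L0 := MkL0 { L0_val :> Linf mu ; _ : L0_val \in L0_pred }.

HB.instance Definition _ := [isSub for L0_val].
HB.instance Definition _ := [Choice of L0 by <:].

Global Instance at_infinity_filter : Filter at_infinity.
Proof.
apply: filter_from_filter; first by exists 0.
move=> M N _ _; exists (Num.max M N) => // v /=.
by rewrite ge_max => /andP[].
Qed.

Lemma L0_submod_closed : submod_closed L0_pred.
Proof.
split=> [|a f g /set_mem/= f0 /set_mem/= g0]; apply/mem_set => /=.
  rewrite (_ : (fun _ => _) = cst 0); first exact: cvg_cst.
  apply/funext => v; transitivity ((mu v)%:num * modulus (0 : R[i])) => //.
  by rewrite ComplexField.Normc.normc0 mulr0.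
apply: (@squeeze_cvgr _ _ at_infinity_filter _ (fun=> 0)
    (fun v => modulus a * ((mu v)%:num * modulus (f v)) +
              (mu v)%:num * modulus (g v))).
- apply: nearW => v; rewrite mulr_ge0 ?modulus_ge0//=.
  rewrite mulrCA -mulrDr ler_wpM2l// -ComplexField.Normc.normcM.
  exact: le_normcD.
- exact: cvg_cst.
- rewrite -[X in _ --> X](addr0 (0 : R)) -[X in _ --> X + _](mulr0 (modulus a)).
  by apply: cvgD => //; exact: cvgMl_tmp.
Qed.

HB.instance Definition _ :=
  GRing.isSubmodClosed.Build _ _ L0_pred L0_submod_closed.
HB.instance Definition _ := [SubChoice_isSubLmodule of L0 by <:].

Definition L0_norm (f : L0) : R[i] := `|L0_val f|.

Lemma L0_normD (f g : L0) : L0_norm (f + g) <= L0_norm f + L0_norm g.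
Proof. exact: ler_normD. Qed.

Lemma L0_normZ (a : R[i]) (f : L0) : L0_norm (a *: f) = `|a| * L0_norm f.
Proof. exact: normrZ. Qed.

Lemma L0_norm0_eq0 (f : L0) : L0_norm f = 0 -> f = 0.
Proof. by move=> /normr0_eq0 f0; exact/val_inj. Qed.

HB.instance Definition _ := Lmodule_isNormed.Build R[i] L0
  L0_normD L0_normZ L0_norm0_eq0.

End vanishing.

Section operators.
Context {K : numFieldType} {V W : normedModType K}.

Definition bounded_operator (S : V -> W) : Prop :=
  exists M : K, forall x, `|S x| <= M * `|x|.

Definition compact_operator (S : V -> W) : Prop :=
  precompact (S @` [set x | `|x| <= 1]).

End operators.

Definition wcomp {R : realType} {T : Type} (psi : T -> R[i]) (phi : T -> T)
  (f : T -> R[i]) : T -> R[i] := fun v => psi v * f (phi v).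

(* X is a normed space of functions on T, with elements seen as functions
   through j. Both properties include that W maps X to itself. *)
Section operators_on_function_space.
Context {R : realType} {T : Type} {X : normedModType R[i]}.
Variables (j : X -> T -> R[i]) (W : (T -> R[i]) -> T -> R[i]).

Definition bounded_on : Prop := exists S : {linear X -> X},
  (forall f, j (S f) = W (j f)) /\ bounded_operator S.

Definition compact_on : Prop := exists S : {linear X -> X},
  (forall f, j (S f) = W (j f)) /\ compact_operator S.

End operators_on_function_space.

Section rooted_metric_space.
Context {R : realType} {T : metricType R} (o : T).

Definition locally_finite_space : Prop :=
  forall M : R, 0 < M -> finite_set [set v | mdist o v < M].

Definition unbounded_space : Prop :=
  forall M : R, 0 < M -> exists v, M <= mdist o v.

End rooted_metric_space.

Definition tail_sup {R : realType} {T : metricType R} (o : T)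
  (mu : T -> {posnum R}) (psi : T -> R[i]) (phi : T -> T) (N : nat) : \bar R :=
  ereal_sup [set ((mu v)%:num / (mu (phi v))%:num * modulus (psi v))%:E
            | v in [set v | N%:R <= mdist o (phi v)]].

(* Main.v *)
(* Compactness forces the tail condition: the normalised point masses at
   points phi(v) going to infinity lie in the unit ball, and their images tend
   to 0 at every point while their norms are at least mu(v)/mu(phi(v)) |psi(v)|.
   Conversely, the tail condition makes W continuous from the unit ball of
   L^oo_mu, with pointwise convergence, into the norm topology: away from a
   finite set of values of phi everything is uniformly small.  The ball is
   compact by Tychonoff, hence so is its image.  When W is bounded on L^0_mu,
   this image lies in L^0_mu, which settles that case too although the unit
   ball of L^0_mu is not pointwise compact. *)
Require Import Defs.
From HB Require Import structures.
From mathcomp Require Import all_boot all_order all_algebra.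
From mathcomp Require Import all_classical all_reals all_analysis.
From mathcomp Require Import complex ring.

Set Implicit Arguments.
Unset Strict Implicit.
Unset Printing Implicit Defensive.

Import Order.TTheory GRing.Theory Num.Theory.
Import numFieldNormedType.Exports.

Local Open Scope classical_set_scope.
Local Open Scope ring_scope.
Local Open Scope complex_scope.

Import ComplexField.Normc.

(** * Finite intersections in a filter, and the complex modulus against its coordinates *)

Lemma near_finite_set (U : Type) (I : choiceType) (A : set I)
    (P : I -> U -> Prop) (F : set_system U) {FF : Filter F} : finite_set A ->
  (forall i, A i -> \forall x \near F, P i x) ->
  \forall x \near F, forall i, A i -> P i x.
Proof.
move=> /finite_fsetP[D ->] DP.
by apply: filterS (filter_bigI FF DP) => x xP i Di; exact: xP.
Qed.

Lemma modulus_le_ReIm (R : realType) (a b : R) :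
  modulus (a +i* b) <= `|a| + `|b|.
Proof.
have -> : a +i* b = a%:C + (0 +i* b) by simpc.
rewrite (le_trans (le_normcD _ _))//.
by rewrite /= expr0n/= add0r addr0 !sqrtr_sqr.
Qed.

Lemma ReIm_le_modulus (R : realType) (w : R[i]) :
  `|complex.Re w| <= modulus w /\ `|complex.Im w| <= modulus w.
Proof.
by case: w => a b; split; rewrite -sqrtr_sqr ler_wsqrtr// ?lerDl ?lerDr sqr_ge0.
Qed.

(** * The tail condition in epsilon form *)

Section tail_condition.
Context {R : realType} {T : metricType R} (o : T) (mu : T -> {posnum R}).
Context (psi : T -> R[i]) (phi : T -> T).

Definition weight_vanishing : Prop :=
  forall e : R, 0 < e -> exists M : R, forall v, M <= mdist o (phi v) ->
    (mu v)%:num / (mu (phi v))%:num * modulus (psi v) <= e.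

(** Otherwise the range of [phi] would lie in a ball, which is finite. *)
Lemma mdist_range_unbounded : locally_finite_space o ->
  infinite_set (range phi) -> forall M : R, exists v, M <= mdist o (phi v).
Proof.
move=> lf phi_inf M; apply: contrapT => /forallNP phiM; apply: phi_inf.
(* Local finiteness speaks of positive radii only, hence the maximum with 1. *)
apply: sub_finite_set (lf (Num.max M 1) _); last by rewrite lt_max ltr01 orbT.
by move=> _ [v _ <-] /=; rewrite lt_max ltNge; have /negP -> := phiM v.
Qed.

(* The range condition matters here: a supremum over the empty set is -oo. *)
Lemma tail_sup_cvg0P : (forall M : R, exists v, M <= mdist o (phi v)) ->
  tail_sup o mu psi phi N @[N --> \oo] --> 0%E <-> weight_vanishing.
Proof.
move=> unb; split=> [/fine_cvgP[tfin /cvgrPdist_le tcvg] e e0|tail].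
  have [N _ /(_ N (leqnn N))[Nfin Ne]] := filterI tfin (tcvg e e0).
  exists N%:R => v Nv; rewrite -lee_fin.
  apply: (@le_trans _ _ (tail_sup o mu psi phi N)).
    by apply: ereal_sup_ubound; exists v.
  rewrite -(fineK Nfin) lee_fin (le_trans (ler_norm _))//.
  by move: Ne; rewrite sub0r normrN.
have tail_ge0 N : (0 <= tail_sup o mu psi phi N)%E.
  have [v Nv] := unb N%:R.
  apply: (@le_trans _ _
    ((mu v)%:num / (mu (phi v))%:num * modulus (psi v))%:E).
    by rewrite lee_fin mulr_ge0 ?modulus_ge0.
  by apply: ereal_sup_ubound; exists v.
have tail_le e : 0 < e -> \forall N \near \oo,
    (tail_sup o mu psi phi N <= e%:E)%E.
  move=> e0; have [M Me] := tail e e0.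
  near=> N; apply: ge_ereal_sup => _ [v Nv <-]; rewrite lee_fin Me//.
  apply: le_trans Nv; near: N; exact: nbhs_infty_ger.
apply/fine_cvgP; split.
  near=> N; rewrite ge0_fin_numE// (@le_lt_trans _ _ 1%:E) ?ltry//.
  by near: N; exact: tail_le.
apply/cvgrPdist_le => e e0; near=> N.
rewrite sub0r normrN ger0_norm ?fine_ge0//=.
have : (tail_sup o mu psi phi N <= e%:E)%E by near: N; exact: tail_le.
by move: (tail_ge0 N); case: (tail_sup _ _ _ _ _).
Unshelve. all: by end_near. Qed.

End tail_condition.

(** * Bounded and compact operators on a space normed by a weighted supremum *)

Section weighted_sup_space.
Context {R : realType} {T : metricType R} (mu : T -> {posnum R}).

(** What both spaces share, so that each implication is proved once: [wss_ub] and [wss_le] identify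
    the norm, [wss_point] supplies point masses. *)
Record weighted_sup_space (X : normedModType R[i]) (j : X -> T -> R[i]) :
    Prop := WeightedSupSpace {
  wss_sub : forall f g v, j (f - g) v = j f v - j g v ;
  wss_ub : forall f v, ((mu v)%:num * modulus (j f v))%:C <= `|f| ;
  wss_le : forall f (c : R), 0 <= c ->
    (forall v, (mu v)%:num * modulus (j f v) <= c) -> `|f| <= c%:C ;
  wss_point : forall a (z : R[i]), exists f,
    forall v, j f v = if v == a then z else 0 }.

Context {X : normedModType R[i]} (j : X -> T -> R[i]).
Hypothesis jX : weighted_sup_space j.

Lemma wss_unit_point a : exists f, `|f| <= 1 /\
  forall v, j f v = if v == a then ((mu a)%:num^-1)%:C else 0.
Proof.
have [f fE] := wss_point jX a ((mu a)%:num^-1)%:C.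
exists f; split=> //; apply: (wss_le jX) => // v; rewrite fE.
case: eqVneq => [->|_]; last by rewrite normc0 mulr0.
by rewrite /= expr0n/= addr0 sqrtr_sqr ger0_norm// divff.
Qed.

Context (o : T) (psi : T -> R[i]) (phi : T -> T) (S : {linear X -> X}).
Hypothesis SE : forall f, j (S f) = wcomp psi phi (j f).

(** Apply [S] to the normalised point mass at [phi v] and evaluate the image at [v]. *)
Lemma bounded_operator_weight_le : bounded_operator S ->
  exists2 C : R, 0 <= C &
    forall v, (mu v)%:num * modulus (psi v) <= C * (mu (phi v))%:num.
Proof.
move=> [M SM]; exists (modulus M); first exact: modulus_ge0.
move=> v; have [f [f1 fE]] := wss_unit_point (phi v).
rewrite -ler_pdivrMr// -lecR.
have normcE' (z : R[i]) : `|z| = (modulus z)%:C by case: z.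
rewrite -normcE'; apply: (@le_trans _ _ `|S f|).
  apply: le_trans (wss_ub jX (S f) v).
  rewrite SE /wcomp fE eqxx normcM lecR /= expr0n/= addr0 sqrtr_sqr.
  by rewrite ger0_norm// mulrA.
(* [M] is a complex scalar of unknown sign, but [M * |f|] dominates a norm, so it equals its
   absolute value and [|M|] can replace [M]. *)
have SfM := SM f; have M0 := le_trans (normr_ge0 (S f)) SfM.
by rewrite (le_trans SfM)// -(ger0_norm M0) normrM normr_id ler_piMr.
Qed.

Lemma compact_operator_tail :
  compact_operator S -> weight_vanishing o mu psi phi.
Proof.
rewrite /compact_operator precompactE => Sc e e0.
apply: contrapT => /forallNP tail.
have /choice[v vP] : forall N : nat, exists v, N%:R <= mdist o (phi v) /\
    e < (mu v)%:num / (mu (phi v))%:num * modulus (psi v).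
  move=> N; have /existsNP[v /not_implyP[Nv ev]] := tail N%:R.
  by exists v; split=> //; rewrite ltNge; exact/negP.
have /choice[f fP] := fun N => wss_unit_point (phi (v N)).
have SfE N w : j (S (f N)) w =
    if phi w == phi (v N) then psi w * ((mu (phi (v N)))%:num^-1)%:C else 0.
  by rewrite SE /wcomp (fP N).2; case: ifP => // _; rewrite mulr0.
have Sfc : (S \o f @ \oo) (closure (S @` [set g | `|g| <= 1])).
  by exists 0%N => // N _; apply: subset_closure; exists (f N) => //;
    case: (fP N).
have [x [_ xcl]] := Sc _ (fmap_proper_filter _ _) Sfc.
(* A cluster point is enough: every tail of the sequence [S (f N)] comes arbitrarily close to
   [x]. *)
have clx (d : R) N0 : 0 < d ->
    exists2 N, (N0 <= N)%N & `|x - S (f N)| < d%:C.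
  move=> d0; have [||_ [[N N0N <-] dN]] :=
      xcl ((S \o f) @` [set N | (N0 <= N)%N]) (ball x d%:C).
  - by exists N0 => // N /= N0N; exists N.
  - by apply: nbhsx_ballx; rewrite ltcR.
  - by exists N => //; move: dN; rewrite -ball_normE.
have x0 w : j x w = 0.
  apply: eq0_normc; apply/eqP; rewrite eq_le modulus_ge0 andbT.
  rewrite -(pmulr_rle0 _ (ltac:(done) : 0 < (mu w)%:num)).
  apply/ler_addgt0Pl => d d0; rewrite addr0.
  (* Such an [N] exceeds [|phi w|], so [phi w] differs from [phi (v N)] and [S (f N)] vanishes at
     [w]. *)
  have [N kN xN] := clx d (Num.truncn (mdist o (phi w))).+1 d0.
  rewrite -lecR; apply: le_trans (ltW xN).
  apply: le_trans (wss_ub jX _ w).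
  rewrite (wss_sub jX) SfE ifF ?subr0//.
  apply/negP => /eqP wE; have := (vP N).1; rewrite -wE.
  rewrite leNgt => /negP; apply.
  by rewrite (lt_le_trans (truncnS_gt _))// ler_nat.
(* As [x] vanishes, [S (f N)] has norm below [e] for some [N]; its value at [v N] contradicts the
   choice of [v]. *)
have [N _ xN] := clx e 0 e0.
have := le_lt_trans (wss_ub jX _ (v N)) xN.
rewrite (wss_sub jX) x0 sub0r normcN SfE eqxx normcM /= expr0n/= addr0.
rewrite sqrtr_sqr ger0_norm// ltcR mulrCA mulrC.
by rewrite ltNge (ltW (vP N).2).
Qed.


(* The rectangles [-1/mu v, 1/mu v]^2 contain the discs of radius 1/mu v, so
   only the compactness of real segments is needed. *)
Lemma tail_compact_operator (C : R) : locally_finite_space o -> 0 <= C ->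
  (forall v, (mu v)%:num * modulus (psi v) <= C * (mu (phi v))%:num) ->
  weight_vanishing o mu psi phi ->
  (forall f : T -> R[i], (forall v, (mu v)%:num * modulus (f v) <= 2) ->
    exists g, j g = wcomp psi phi f) ->
  compact_operator S.
Proof.
move=> lf C0 WC tail Wj.
pose Q v := `[- (mu v)%:num^-1, (mu v)%:num^-1]%classic : set R.
pose K := [set x : prod_topology (fun _ : T => (R * R)%type) |
  forall v, (Q v `*` Q v) (x v)].
pose z (x : T -> R * R) v := (x v).1 +i* (x v).2.
(* Two coordinates, each at most [1 / mu v], account for the 2 in the hypothesis on [f]. *)
have zK x v : K x -> (mu v)%:num * modulus (z x v) <= 2.
  move=> /(_ v)[]; rewrite /Q /= !in_itv/= -!ler_norml => x1 x2.
  rewrite mulrC -ler_pdivlMr// (le_trans (modulus_le_ReIm _ _))//.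
  by rewrite mulrDl mul1r lerD.
(* [G] extends the operator to all of [K], whose points need not come from [X]; outside [K] its
   value is arbitrary. *)
have /choice[G GE] : forall x, exists g, K x -> j g = wcomp psi phi (z x).
  move=> x; have [Kx|] := pselect (K x); last by exists 0.
  by have [g gE] := Wj (z x) (fun v => zK x v Kx); exists g.
have Kc : compact K.
  apply: (@tychonoff T (fun=> (R * R)%type) (fun v => Q v `*` Q v)) => v.
  by apply: compact_setX; exact: segment_compact.
have Gc : {within K, continuous G}.
  apply/subspace_continuousP => x Kx; apply/cvgrPdist_le => -[e e'].
  rewrite ltcE/= => /andP[/eqP -> e0]; have e40 : 0 < e / 4 by rewrite divr_gt0.
  have [M Me] := tail _ e40.
  (* Chosen so that [C * mu w * (2 * d w)] is [e * (C / (C + 1))], at most [e]; [C + 1] is nonzero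
     even if [C] is 0. *)
  pose d w := e / (2 * (C + 1) * (mu w)%:num).
  have d0 w : 0 < d w by rewrite divr_gt0// !mulr_gt0// ltr_wpDl.
  (* A product neighbourhood controls finitely many coordinates, which suffices because the ball is
     finite. *)
  have near_lf : \forall y \near x, forall w, mdist o w < Num.max M 1 ->
      ball (x w) (d w) (y w).
    have lfM : finite_set [set w | mdist o w < Num.max M 1].
      by apply: lf; rewrite lt_max ltr01 orbT.
    have FF : Filter (nbhs x) by exact: nbhs_filter.
    apply: (near_finite_set (FF := FF) lfM) => w _.
    apply: (@proj_continuous T (fun=> (R * R)%type) w x).
    exact: nbhsx_ballx.
  rewrite /= near_withinE; near=> y => Ky.
  have xy w : mdist o w < Num.max M 1 -> ball (x w) (d w) (y w).
    by move: w; near: y; exact: near_lf.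
  apply: (wss_le jX); first exact: ltW.
  move=> v; rewrite (wss_sub jX) !GE// /wcomp -mulrBr normcM.
  (* Far values of [phi] are handled by the tail bound [e / 4] and the diameter bound [2 + 2], near
     ones by closeness of coordinates. *)
  have [Mv|vM] := leP M (mdist o (phi v)).
    have zxy : (mu (phi v))%:num * modulus (z x (phi v) - z y (phi v)) <= 2 + 2.
      apply: le_trans (lerD (zK _ (phi v) Kx) (zK _ (phi v) Ky)).
      rewrite -mulrDr ler_wpM2l//.
      by rewrite -(normcN (z y (phi v))) le_normcD.
    have -> : (mu v)%:num *
          (modulus (psi v) * modulus (z x (phi v) - z y (phi v))) =
        (mu v)%:num / (mu (phi v))%:num * modulus (psi v) *
          ((mu (phi v))%:num * modulus (z x (phi v) - z y (phi v))).
      by field.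
    have -> : e = e / 4 * (2 + 2) by field.
    by rewrite ler_pM ?mulr_ge0 ?modulus_ge0// Me.
  have [x1 x2] : ball (x (phi v)) (d (phi v)) (y (phi v)).
    by apply: xy; rewrite lt_max vM.
  have zd : modulus (z x (phi v) - z y (phi v)) <= 2 * d (phi v).
    rewrite (le_trans (modulus_le_ReIm _ _))// mulrDl mul1r.
    by rewrite lerD// ltW.
  rewrite mulrA (le_trans (ler_pM _ _ (WC v) zd)) ?mulr_ge0 ?modulus_ge0//.
  have C1 : C + 1 != 0 by rewrite gt_eqF// ltr_wpDl.
  have -> : C * (mu (phi v))%:num * (2 * d (phi v)) = e * (C / (C + 1)).
    by rewrite /d; field; rewrite C1 /=.
  rewrite ler_piMr ?(ltW e0)// ler_pdivrMr ?mul1r ?lerDl//.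
  by rewrite ltr_wpDl.
apply: precompact_subset (compact_precompact (@norm_hausdorff _ X)
  (continuous_compact Gc Kc)).
move=> _ [f f1 <-].
pose x v := (complex.Re (j f v), complex.Im (j f v)).
have Kx : K x.
  move=> v; rewrite /Q /= !in_itv/= -!ler_norml.
  have [ReS ImS] := ReIm_le_modulus (j f v).
  suff jf : modulus (j f v) <= (mu v)%:num^-1.
    by rewrite (le_trans ReS) ?(le_trans ImS).
  rewrite -[leRHS]mul1r ler_pdivlMr// mulrC -lecR.
  exact: le_trans (wss_ub jX f v) f1.
exists x => //; apply/eqP; rewrite -subr_eq0 -normr_le0.
apply: (wss_le jX) => // v; rewrite (wss_sub jX) SE GE// [z _](_ : _ = j f).
  by rewrite subrr normc0 mulr0.
by apply/funext => w; rewrite /z /=; case: (j f w).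
Unshelve. all: by end_near. Qed.

End weighted_sup_space.

(** * The two concrete spaces, and images of bounded functions in them *)

Section the_spaces.
Context {R : realType} {T : metricType R} (o : T) (mu : T -> {posnum R}).

Lemma Linf_weighted_sup_space :
  weighted_sup_space mu (fun f : Linf mu => f : T -> R[i]).
Proof.
split=> [//|f v|f c c0 fc|a z].
- by rewrite lecR; exact: wsup_ub.
- by rewrite lecR; exact: wsup_le.
- have aP : (fun v => if v == a then z else 0) \in Linf_pred mu.
    apply/Linf_predP; exists ((mu a)%:num * modulus z).
      by rewrite mulr_ge0// modulus_ge0.
    move=> v; case: eqVneq => [->//|_].
    by rewrite normc0 mulr0 mulr_ge0// modulus_ge0.
  by exists (MkLinf aP).
Qed.

Lemma L0_weighted_sup_space :
  weighted_sup_space mu (fun f : L0 o mu => f : T -> R[i]).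
Proof.
split=> [//|f v|f c c0 fc|a z].
- exact: (wss_ub Linf_weighted_sup_space).
- exact: (wss_le Linf_weighted_sup_space).
- have [f fE] := wss_point Linf_weighted_sup_space a z.
  have fP : f \in @L0_pred R T o mu.
    apply/mem_set => /=; apply/cvgrPdist_le => e e0.
    (* The added 1 keeps [a] itself out of the neighbourhood of infinity. *)
    exists (mdist o a + 1) => // v /= av; rewrite fE ifF.
      by rewrite normc0 mulr0 subrr normr0 ltW.
    by apply/eqP => va; move: av; rewrite va gerDl ler10.
  by exists (MkL0 fP).
Qed.

Lemma wcomp_Linf (psi : T -> R[i]) (phi : T -> T) (C : R) (f : T -> R[i]) :
  (forall v, (mu v)%:num * modulus (psi v) <= C * (mu (phi v))%:num) ->
  0 <= C -> (forall v, (mu v)%:num * modulus (f v) <= 2) ->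
  exists g : Linf mu, g = wcomp psi phi f :> (T -> R[i]).
Proof.
move=> WC C0 f2; have gP : wcomp psi phi f \in Linf_pred mu.
  apply/Linf_predP; exists (C * 2); first by rewrite mulr_ge0.
  move=> v; rewrite /wcomp normcM mulrA.
  apply: (@le_trans _ _ (C * (mu (phi v))%:num * modulus (f (phi v)))).
    by rewrite ler_wpM2r ?modulus_ge0.
  by rewrite -mulrA ler_wpM2l.
by exists (MkLinf gP).
Qed.

(** Here [f] is only bounded, not vanishing at infinity. Where [phi v] is far, the tail condition
    makes the image small; over each of the finitely many near values [w], the image under [S] of
    the point mass at [w] vanishes at infinity, which makes [mu v |psi v|] small on the fibre. *)
Lemma wcomp_L0 (psi : T -> R[i]) (phi : T -> T)
    (S : {linear L0 o mu -> L0 o mu}) (g : Linf mu) (f : T -> R[i]) :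
  locally_finite_space o ->
  (forall f : L0 o mu, S f = wcomp psi phi f :> (T -> R[i])) ->
  weight_vanishing o mu psi phi ->
  (forall v, (mu v)%:num * modulus (f v) <= 2) ->
  g = wcomp psi phi f :> (T -> R[i]) -> g \in @L0_pred R T o mu.
Proof.
move=> lf SE tail f2 gE; apply/mem_set => /=; apply/cvgrPdist_le => e e0.
have e20 : 0 < e / 2 by rewrite divr_gt0.
have [M Me] := tail _ e20.
have lfM : finite_set [set w | mdist o w < Num.max M 1].
  by apply: lf; rewrite lt_max ltr01 orbT.
have near_w w : mdist o w < Num.max M 1 -> \forall v \near at_infinity o,
    phi v = w -> (mu v)%:num * modulus (psi v) <= e / 2 * (mu w)%:num.
  move=> _; have [h hE] := wss_point L0_weighted_sup_space w 1.
  have /set_mem/= /cvgrPdist_le := valP (S h).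
  (* The factor [mu w] is absorbed by the bound [mu w |f w| <= 2], leaving [e]. *)
  move=> /(_ (e / 2 * (mu w)%:num)); rewrite mulr_gt0// => /(_ isT).
  apply: filterS => v + vw; rewrite sub0r normrN SE /wcomp hE vw eqxx mulr1.
  by rewrite ger0_norm// mulr_ge0// modulus_ge0.
have := near_finite_set (FF := at_infinity_filter o) lfM near_w.
apply: filterS => v near_v.
rewrite sub0r normrN ger0_norm ?mulr_ge0 ?modulus_ge0// gE /wcomp normcM.
have psiv : (mu v)%:num * modulus (psi v) <= e / 2 * (mu (phi v))%:num.
  have [Mv|vM] := leP M (mdist o (phi v)).
    by rewrite -ler_pdivrMr// mulrAC Me.
  by apply: near_v => //=; rewrite lt_max vM.
rewrite mulrA (le_trans (ler_wpM2r (modulus_ge0 _) psiv))//.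
rewrite -[leLHS]mulrA (le_trans (ler_wpM2l (ltW e20) (f2 _)))//.
by rewrite divfK.
Qed.

End the_spaces.

Theorem corollary4p5 (R : realType) (T : metricType R) (o : T)
    (T_lf : locally_finite_space o) (T_unbounded : unbounded_space o)
    (mu : T -> {posnum R}) (psi : T -> R[i]) (phi : T -> T)
    (phi_inf : infinite_set (range phi)) :
  (bounded_on (fun f : Linf mu => f : T -> R[i]) (wcomp psi phi) ->
    (compact_on (fun f : Linf mu => f : T -> R[i]) (wcomp psi phi) <->
     tail_sup o mu psi phi N @[N --> \oo] --> 0%E))
  /\
  (bounded_on (fun f : L0 o mu => f : T -> R[i]) (wcomp psi phi) ->
    (compact_on (fun f : L0 o mu => f : T -> R[i]) (wcomp psi phi) <->
     tail_sup o mu psi phi N @[N --> \oo] --> 0%E)).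
Proof.
have tailP := tail_sup_cvg0P mu psi (mdist_range_unbounded T_lf phi_inf).
split=> -[S [SE Sb]].
  have jX := Linf_weighted_sup_space mu.
  have [C C0 WC] := bounded_operator_weight_le jX SE Sb.
  split=> [[S' [S'E S'c]]|/tailP tail].
    by apply/tailP; exact: (compact_operator_tail jX o S'E S'c).
  exists S; split=> //.
  apply: (tail_compact_operator jX SE T_lf C0 WC tail) => f f2.
  exact: (wcomp_Linf WC C0 f2).
have jX := L0_weighted_sup_space o mu.
have [C C0 WC] := bounded_operator_weight_le jX SE Sb.
split=> [[S' [S'E S'c]]|/tailP tail].
  by apply/tailP; exact: (compact_operator_tail jX o S'E S'c).
exists S; split=> //.
apply: (tail_compact_operator jX SE T_lf C0 WC tail) => f f2.
(* The image is first built in the larger space, then shown to vanish at infinity. *)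
have [g gE] := wcomp_Linf WC C0 f2.
by exists (MkL0 (wcomp_L0 T_lf SE tail f2 gE)).
Qed.
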